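(* Let $k\ge2$ and consider the NODE system $\dot x_{nn}=Ax_{nn}+Z_{nn}(x_{nn})$ on $\mathbb{R}^n$, where $Z_{nn}$ is a $k$-hidden-layer feedforward network whose activation functions are incrementally sector bounded by $[K_1^i,K_2^i]$, $i=1,\dots,k$. Let $\mathcal{C}\subseteq\mathcal{D}$ be a set on which the system is forward complete and forward invariant. Suppose there exist a positive definite matrix $P\in\mathbb{R}^{n\times n}$ and positive constants $\underline{p},\overline{p},\mu$ such that $\underline{p}I\le P\le\overline{p}I$ and $$\bar U_1^\top\begin{bmatrix}-\mu I&P&0\\P&A^\top P+PA&PW^{k+1}\\0&W^{(k+1)\top}P&0\end{bmatrix}\bar U_1+\bar U_2^\top\begin{bmatrix}0&0&0\\0&-2Q_1^\top Q_2&Q_1^\top+Q_2^\top\\0&Q_1+Q_2&-2I\end{bmatrix}\bar U_2\le0 .$$ Then the NODE system is contractive in $\mathcal{C}$.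
   Context: Network. $n=m_0=m_{k+1}$, $A\in\mathbb{R}^{n\times n}$. For input $x\in\mathbb{R}^n$: $w^0=x$, $w^{i+1}=\phi^{i+1}(W^{i+1}w^i+b^{i+1})$ for $i=0,\dots,k-1$, and $Z_{nn}(x)=W^{k+1}w^k+b^{k+1}$, with $W^{i+1}\in\mathbb{R}^{m_{i+1}\times m_i}$, $b^{i+1}\in\mathbb{R}^{m_{i+1}}$. Each $\phi^i:\mathbb{R}^{m_i}\to\mathbb{R}^{m_i}$ acts componentwise through differentiable scalar activation functions $\varphi^i_j$, $j=1,\dots,m_i$. $\mathcal{D}\subseteq\mathbb{R}^n$ is a given set of states. Incremental sector bound $[K_1^i,K_2^i]$: $K_1^i=\mathrm{diag}(\alpha^i_1,\dots,\alpha^i_{m_i})$, $K_2^i=\mathrm{diag}(\beta^i_1,\dots,\beta^i_{m_i})$ with $\alpha^i_j\le\beta^i_j$ real, and $(\varphi^i_j(s)-\varphi^i_j(t)-\alpha^i_j(s-t))(\varphi^i_j(s)-\varphi^i_j(t)-\beta^i_j(s-t))\le0$ for all $s,t$ in the set of values of the $j$-th component of $W^iw^{i-1}+b^i$ as the network input $x$ ranges over $\mathcal{D}$. Matrices. $Q_1=\mathrm{blockdiag}(K_1^1W^1,\dots,K_1^kW^k)$, $Q_2=\mathrm{blockdiag}(K_2^1W^1,\dots,K_2^kW^k)$; $a=\sum_{i=1}^{k-1}m_i$; $$\bar U_1=\begin{bmatrix}I_n&0_{n\times n}&0_{n\times a}&0_{n\times m_k}\\0_{n\times n}&I_n&0_{n\times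 a}&0_{n\times m_k}\\0_{m_k\times n}&0_{m_k\times n}&0_{m_k\times a}&I_{m_k}\end{bmatrix},\qquad \bar U_2=\begin{bmatrix}I_n&0_{n\times n}&0_{n\times a}&0_{n\times m_k}\\0_{n\times n}&I_n&0_{n\times a}&0_{n\times m_k}\\0_{a\times n}&0_{a\times n}&I_a&0_{a\times m_k}\\0_{a\times n}&0_{a\times n}&I_a&0_{a\times m_k}\\0_{m_k\times n}&0_{m_k\times n}&0_{m_k\times a}&I_{m_k}\end{bmatrix}.$$ Forward complete and forward invariant on $\mathcal{C}$: for any $x_{nn}(0)\in\mathcal{C}$ the trajectory exists and satisfies $x_{nn}(t)\in\mathcal{C}$ for all $t\ge0$. Contractive in a forward invariant set $\mathcal{C}$: there exist $c>0$, $\rho>0$ such that any two solutions with initial conditions in $\mathcal{C}$ satisfy $\|x_{nn1}(t)-x_{nn2}(t)\|\le ce^{-\rho t}\|x_{nn1}(0)-x_{nn2}(0)\|$ for all $t\ge0$ ($\|\cdot\|$ a fixed norm on $\mathbb{R}^n$). For symmetric matrices, $B\le C$ means $B-C$ is negative semidefinite. *)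

(* Defs.v *)
From HB Require Import structures.
From mathcomp Require Import all_boot all_order all_algebra.
From mathcomp Require Import all_classical all_reals all_analysis.
Set Implicit Arguments.
Unset Strict Implicit.
Unset Printing Implicit Defensive.
Import Order.TTheory GRing.Theory Num.Theory.
Import numFieldNormedType.Exports.
Local Open Scope classical_set_scope.
Local Open Scope ring_scope.

(* A network with k hidden layers from R^n to R^n, n = width 0.  Layers are
   indexed from 0: [weight i], [bias i] and [act i] are W^{i+1}, b^{i+1} and
   (varphi^{i+1}_j)_j for i < k, the values at i >= k being unused.  The output
   layer W^{k+1}, b^{k+1} is kept apart so that m_{k+1} = m_0 needs no cast. *)
Record network (R : realType) (k : nat) := Network {
  width : nat -> nat;
  weight : forall i, 'M[R]_(width i.+1, width i);
  bias : forall i, 'cV[R]_(width i.+1);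
  act : forall i, 'I_(width i.+1) -> R -> R;
  weight_out : 'M[R]_(width 0, width k);
  bias_out : 'cV[R]_(width 0)
}.

Section Network.
Variables (R : realType) (k : nat) (N : network R k).
Implicit Types x : 'cV[R]_(width N 0).

Fixpoint hidden x (i : nat) : 'cV[R]_(width N i) :=
  if i is i'.+1 then
    \col_j act j ((weight N i' *m hidden x i' + bias N i') j 0)
  else x.

(* the argument W^{i+1} w^i + b^{i+1} of phi^{i+1} *)
Definition preact x (i : nat) : 'cV[R]_(width N i.+1) :=
  weight N i *m hidden x i + bias N i.

Definition net x : 'cV[R]_(width N 0) :=
  weight_out N *m hidden x k + bias_out N.

Definition act_differentiable :=
  forall (i : nat) (j : 'I_(width N i.+1)) (s : R), (i < k)%N ->
    derivable (act j) s 1.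

Definition preact_values (D : set 'cV[R]_(width N 0)) i
    (j : 'I_(width N i.+1)) : set R :=
  [set preact x i j 0 | x in D].

(* [al i] and [be i] are the diagonals of K_1^{i+1} and K_2^{i+1}. *)
Definition incremental_sector_bounded (D : set 'cV[R]_(width N 0))
    (al be : forall i, 'rV[R]_(width N i.+1)) :=
  forall (i : nat) (j : 'I_(width N i.+1)), (i < k)%N ->
    al i 0 j <= be i 0 j /\
    forall s t, preact_values D j s -> preact_values D j t ->
      (act j s - act j t - al i 0 j * (s - t)) *
      (act j s - act j t - be i 0 j * (s - t)) <= 0.

(* a = m_1 + ... + m_{k-1} *)
Definition inner_width := (\sum_(i < k.-1) width N i.+1)%N.

Lemma outputs_width : (1 < k)%N ->
  (\sum_(i < k) width N i.+1 = inner_width + width N k)%N.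
Proof.
rewrite /inner_width; move: (width N) => m.
by case: k => // k' _; rewrite big_ord_recr.
Qed.

Lemma inputs_width : (1 < k)%N ->
  (\sum_(i < k) width N i = width N 0 + inner_width)%N.
Proof.
rewrite /inner_width; move: (width N) => m.
by case: k => // k' _; rewrite big_ord_recl.
Qed.

(* blockdiag(K^1 W^1, ..., K^k W^k) with K^{i+1} = diag (d i); as in [\mxdiag],
   [conform_mx] only serves to type the diagonal blocks. *)
Definition blockdiag_KW (k2 : (1 < k)%N)
    (d : forall i, 'rV[R]_(width N i.+1)) :
    'M[R]_(inner_width + width N k, width N 0 + inner_width) :=
  castmx (outputs_width k2, inputs_width k2)
    (\mxblock_(i < k, j < k)
      if i == j then conform_mx 0 (diag_mx (d i) *m weight N i) else 0).

End Network.

Section BlockMatrices.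
Variable R : realType.

Definition block3_mx m1 m2 m3 n1 n2 n3
    (A11 : 'M[R]_(m1, n1)) (A12 : 'M[R]_(m1, n2)) (A13 : 'M[R]_(m1, n3))
    (A21 : 'M[R]_(m2, n1)) (A22 : 'M[R]_(m2, n2)) (A23 : 'M[R]_(m2, n3))
    (A31 : 'M[R]_(m3, n1)) (A32 : 'M[R]_(m3, n2)) (A33 : 'M[R]_(m3, n3)) :
    'M[R]_(m1 + (m2 + m3), n1 + (n2 + n3)) :=
  col_mx (row_mx A11 (row_mx A12 A13))
    (col_mx (row_mx A21 (row_mx A22 A23))
            (row_mx A31 (row_mx A32 A33))).

Definition row4_mx m n1 n2 n3 n4
    (A1 : 'M[R]_(m, n1)) (A2 : 'M[R]_(m, n2))
    (A3 : 'M[R]_(m, n3)) (A4 : 'M[R]_(m, n4)) :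
    'M[R]_(m, n1 + (n2 + (n3 + n4))) :=
  row_mx A1 (row_mx A2 (row_mx A3 A4)).

Definition U1bar (n a mk : nat) : 'M[R]_(n + (n + mk), n + (n + (a + mk))) :=
  col_mx (row4_mx 1%:M 0 0 0)
    (col_mx (row4_mx 0 1%:M 0 0)
            (row4_mx 0 0 0 1%:M)).

(* The five block rows are grouped as 1 + 2 + 2 to match the 3 x 3 block
   matrix that U2bar multiplies. *)
Definition U2bar (n a mk : nat) :
    'M[R]_(n + ((n + a) + (a + mk)), n + (n + (a + mk))) :=
  col_mx (row4_mx 1%:M 0 0 0)
    (col_mx (col_mx (row4_mx 0 1%:M 0 0)
                    (row4_mx 0 0 1%:M 0))
            (col_mx (row4_mx 0 0 1%:M 0)
                    (row4_mx 0 0 0 1%:M))).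

Definition quad_form n (B : 'M[R]_n) (v : 'cV[R]_n) : R := (v^T *m B *m v) 0 0.

Definition posdef_mx n (B : 'M[R]_n) :=
  B^T = B /\ forall v, v != 0 -> 0 < quad_form B v.

Definition negsemidef_mx n (B : 'M[R]_n) :=
  B^T = B /\ forall v, quad_form B v <= 0.

Definition loewner_le n (B C : 'M[R]_n) := negsemidef_mx (B - C).

End BlockMatrices.

Section Dynamics.
Variables (R : realType) (n : nat).
Implicit Types (f : 'cV[R]_n -> 'cV[R]_n) (C : set 'cV[R]_n).

(* x' = f(x) on [0, +oo[, the derivative being one-sided at 0; the values of x
   at negative times are irrelevant. *)
Definition solution f (x : R -> 'cV[R]_n) :=
  forall t, 0 <= t ->
    h^-1 *: (x (t + h) - x t) @[h --> within [set h | 0 <= t + h] 0^']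
      --> f (x t).

Definition forward_complete_invariant f C :=
  (forall x0, C x0 -> exists2 x, solution f x & x 0 = x0) /\
  (forall x, solution f x -> C (x 0) -> forall t, 0 <= t -> C (x t)).

Definition is_norm (nrm : 'cV[R]_n -> R) :=
  [/\ forall u v, nrm (u + v) <= nrm u + nrm v,
      forall (c : R) v, nrm (c *: v) = `|c| * nrm v &
      forall v, nrm v = 0 -> v = 0].

Definition contractive f C (nrm : 'cV[R]_n -> R) :=
  exists c rho : R, [/\ 0 < c, 0 < rho &
    forall x1 x2, solution f x1 -> solution f x2 -> C (x1 0) -> C (x2 0) ->
      forall t, 0 <= t ->
        nrm (x1 t - x2 t) <= c * expR (- rho * t) * nrm (x1 0 - x2 0)].

End Dynamics.

Definition node_field (R : realType) (k : nat) (N : network R k)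
    (A : 'M[R]_(width N 0)) (x : 'cV[R]_(width N 0)) : 'cV[R]_(width N 0) :=
  A *m x + net x.
Arguments node_field {R k} N A x.

(* Main.v *)
Require Import Defs.
From HB Require Import structures.
From mathcomp Require Import all_boot all_order all_algebra.
From mathcomp Require Import all_classical all_reals all_analysis.
From mathcomp Require Import ring lra.
Set Implicit Arguments.
Unset Strict Implicit.
Unset Printing Implicit Defensive.

Import Order.TTheory GRing.Theory Num.Theory.
Import numFieldNormedType.Exports.
Local Open Scope classical_set_scope.
Local Open Scope ring_scope.

(* With V x = x^T P x as Lyapunov function, evaluate the matrix inequality at
   (y, dx, dw^1, ..., dw^k), the increments of the states and of the layer
   outputs of two trajectories.  The second summand becomes minus twice the sum
   over all neurons of the products in the incremental sector bound, hence is
   nonnegative, and the first one is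
   - mu |y|^2 + 2 y^T P dx + (d/dt) V dx.  Taking y = (p_lo / mu) dx and using
   p_lo |dx|^2 <= V dx gives (d/dt) V dx <= - (p_lo / mu) V dx, so V dx decays
   exponentially; equivalence of norms transfers this to the given norm. *)

(** * Scalar products, quadratic forms and the evaluated matrix inequality *)

Definition dot {R : realType} {n} (u v : 'cV[R]_n) : R := (u^T *m v) 0 0.

Section Dot.
Variable R : realType.
Implicit Types n m : nat.

Lemma dotE n (u v : 'cV[R]_n) : dot u v = \sum_i u i 0 * v i 0.
Proof. by rewrite /dot mxE; apply: eq_bigr => i _; rewrite mxE. Qed.

Lemma dotC n (u v : 'cV[R]_n) : dot u v = dot v u.
Proof. by rewrite !dotE; apply: eq_bigr => i _; rewrite mulrC. Qed.

Lemma dotDl n (u v w : 'cV[R]_n) : dot (u + v) w = dot u w + dot v w.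
Proof. by rewrite /dot linearD mulmxDl mxE. Qed.

Lemma dotDr n (u v w : 'cV[R]_n) : dot w (u + v) = dot w u + dot w v.
Proof. by rewrite dotC dotDl !(dotC w). Qed.

Lemma dotZl n a (u v : 'cV[R]_n) : dot (a *: u) v = a * dot u v.
Proof. by rewrite /dot linearZ -scalemxAl mxE. Qed.

Lemma dotZr n a (u v : 'cV[R]_n) : dot u (a *: v) = a * dot u v.
Proof. by rewrite dotC dotZl dotC. Qed.

Lemma dotNl n (u v : 'cV[R]_n) : dot (- u) v = - dot u v.
Proof. by rewrite -scaleN1r dotZl mulN1r. Qed.

Lemma dotNr n (u v : 'cV[R]_n) : dot u (- v) = - dot u v.
Proof. by rewrite dotC dotNl dotC. Qed.

Lemma dot0r n (u : 'cV[R]_n) : dot u 0 = 0.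
Proof. by rewrite /dot mulmx0 mxE. Qed.

Lemma dot_mulmxr m n (u : 'cV[R]_m) (M : 'M[R]_(m, n)) (v : 'cV[R]_n) :
  dot u (M *m v) = dot (M^T *m u) v.
Proof. by rewrite /dot trmx_mul trmxK mulmxA. Qed.

Lemma dot_col_mx m n (u u' : 'cV[R]_m) (v v' : 'cV[R]_n) :
  dot (col_mx u v) (col_mx u' v') = dot u u' + dot v v'.
Proof. by rewrite /dot tr_col_mx mul_row_col mxE. Qed.

Lemma dot_castmx m n (e : m = n) (u v : 'cV[R]_m) :
  dot (castmx (e, erefl) u) (castmx (e, erefl) v) = dot u v.
Proof. by case: _ / e; rewrite !castmx_id. Qed.

Lemma dot_mxcol k (m : 'I_k -> nat) (u v : forall i, 'cV[R]_(m i)) :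
  dot (\mxcol_i u i) (\mxcol_i v i) = \sum_i dot (u i) (v i).
Proof. by rewrite /dot tr_mxcol mul_mxrow_mxcol summxE. Qed.

Lemma quad_formE n (B : 'M[R]_n) v : quad_form B v = dot v (B *m v).
Proof. by rewrite /quad_form /dot mulmxA. Qed.

Lemma quad_formD n (B B' : 'M[R]_n) v :
  quad_form (B + B') v = quad_form B v + quad_form B' v.
Proof. by rewrite !quad_formE mulmxDl dotDr. Qed.

Lemma quad_formB n (B B' : 'M[R]_n) v :
  quad_form (B - B') v = quad_form B v - quad_form B' v.
Proof. by rewrite !quad_formE mulmxBl dotDr dotNr. Qed.

Lemma quad_form_scalar n a (v : 'cV[R]_n) : quad_form a%:M v = a * dot v v.
Proof. by rewrite quad_formE mul_scalar_mx dotZr. Qed.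

Lemma quad_form_congr m n (U : 'M[R]_(m, n)) (B : 'M[R]_m) v :
  quad_form (U^T *m B *m U) v = quad_form B (U *m v).
Proof. by rewrite !quad_formE -!mulmxA dot_mulmxr trmxK. Qed.

Lemma quad_form_block3 m1 m2 m3 (A11 : 'M[R]_(m1, m1)) (A12 : 'M[R]_(m1, m2))
    (A13 : 'M[R]_(m1, m3)) (A21 : 'M[R]_(m2, m1)) (A22 : 'M[R]_(m2, m2))
    (A23 : 'M[R]_(m2, m3)) (A31 : 'M[R]_(m3, m1)) (A32 : 'M[R]_(m3, m2))
    (A33 : 'M[R]_(m3, m3)) u v w :
  quad_form (block3_mx A11 A12 A13 A21 A22 A23 A31 A32 A33)
    (col_mx u (col_mx v w)) =
  dot u (A11 *m u) + dot u (A12 *m v) + dot u (A13 *m w) +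
  (dot v (A21 *m u) + dot v (A22 *m v) + dot v (A23 *m w)) +
  (dot w (A31 *m u) + dot w (A32 *m v) + dot w (A33 *m w)).
Proof.
by rewrite quad_formE /block3_mx !(mul_col_mx, mul_row_col) !dot_col_mx !dotDr
  !addrA.
Qed.

Lemma mul_U1bar n a mk (y x : 'cV[R]_n) (s : 'cV[R]_a) (z : 'cV[R]_mk) :
  U1bar R n a mk *m col_mx y (col_mx x (col_mx s z)) = col_mx y (col_mx x z).
Proof.
by rewrite /U1bar /row4_mx !(mul_col_mx, mul_row_col)
  !(mul0mx, mul1mx, add0r, addr0).
Qed.

(** [U2bar] repeats [s], the inner layers: [col_mx x s] stacks the layer inputs and [col_mx s z] the
    layer outputs. *)
Lemma mul_U2bar n a mk (y x : 'cV[R]_n) (s : 'cV[R]_a) (z : 'cV[R]_mk) :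
  U2bar R n a mk *m col_mx y (col_mx x (col_mx s z)) =
  col_mx y (col_mx (col_mx x s) (col_mx s z)).
Proof.
by rewrite /U2bar /row4_mx !(mul_col_mx, mul_row_col)
  !(mul0mx, mul1mx, add0r, addr0).
Qed.

(* The first form is the time derivative of the Lyapunov function, completed by
   the free vector [y]; the second is the S-procedure term
   [- 2 (z - Q1 u)^T (z - Q2 u)], with [u] the layer inputs and [z] the layer
   outputs. *)
Lemma quad_form_lmi n a mk (A P : 'M[R]_n) (W : 'M[R]_(n, mk)) mu
    (Q1 Q2 : 'M[R]_(a + mk, n + a)) (y x : 'cV[R]_n) (s : 'cV[R]_a)
    (z : 'cV[R]_mk) :
  P^T = P ->
  quad_form
    ((U1bar R n a mk)^T *m block3_mx
                (- mu%:M) P                    0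
                P         (A^T *m P + P *m A)  (P *m W)
                0         (W^T *m P)        0 *m U1bar R n a mk
      + (U2bar R n a mk)^T *m block3_mx
                  (0 : 'M[R]_n) 0                       0
                  0             ((-2) *: (Q1^T *m Q2))  (Q1^T + Q2^T)
                  0             (Q1 + Q2)               (- 2%:M) *m U2bar R n a mk)
    (col_mx y (col_mx x (col_mx s z))) =
  - mu * dot y y + 2 * dot y (P *m x) + 2 * dot (P *m x) (A *m x + W *m z)
  - 2 * dot (col_mx s z - Q1 *m col_mx x s) (col_mx s z - Q2 *m col_mx x s).
Proof.
move=> PT; rewrite quad_formD !quad_form_congr mul_U1bar mul_U2bar.
rewrite !quad_form_block3; set u := col_mx x s; set q := col_mx s z.
rewrite !mul0mx !dot0r !mulmxDl !mulNmx !mul_scalar_mx -!scalemxAl.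
rewrite -!mulmxA !dotDr !dotDl !dotNr !dotNl !dotZr.
(* Adjoints and the symmetry of [dot] and [P] bring equal scalars to one common form, leaving only
   ring arithmetic. *)
rewrite !(dot_mulmxr _ P) !(dot_mulmxr _ _^T) !trmxK PT.
rewrite [dot (P *m y) x]dotC [dot x (P *m y)]dot_mulmxr PT.
rewrite [dot (A *m x) _]dotC [dot (W *m z) _]dotC [dot (Q1 *m u) q]dotC.
rewrite [dot (Q2 *m u) q]dotC.
ring.
Qed.

End Dot.

(** * Splitting and casting of block columns *)

Section MxcolNat.
Variable R : realType.

Lemma mxcol_cons (m : nat -> nat) (B : forall i, 'cV[R]_(m i)) k
    (e : (\sum_(i < k.+1) m i = m 0 + \sum_(i < k) m i.+1)%N) :
  castmx (e, erefl) (\mxcol_(i < k.+1) B i) =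
  col_mx (B 0%N) (\mxcol_(i < k) B i.+1).
Proof.
rewrite (mxcol_recu (p_ := fun i : 'I_k.+1 => m i) (fun i => B i)) castmx_comp.
exact: castmx_id.
Qed.

(** The offset involves only the blocks before [i], not [k], so positions can be compared between
    columns with different numbers of blocks. *)
Lemma Rank_nat (m : nat -> nat) k (i : 'I_k) (j : 'I_(m i)) :
  tagnat.Rank (p_ := fun i : 'I_k => m i) i j = (\sum_(l < i) m l + j)%N :> nat.
Proof.
rewrite tagnat.RankEsum; congr (_ + _)%N.
exact: (big_ord_narrow (F := fun l : 'I_k => m l) (ltnW (ltn_ord i))).
Qed.

Lemma mxcol_Rank k (m : 'I_k -> nat) (B : forall i, 'cV[R]_(m i)) i j :
  (\mxcol_i B i) (tagnat.Rank i j) 0 = B i j 0.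
Proof. by rewrite -[in RHS](mxcolK B) [RHS]mxE. Qed.

(** Entrywise comparison: for [i < k] a row has the same position in both block columns; otherwise
    it lies past the first [k] blocks, in [B k]. *)
Lemma mxcol_rcons (m : nat -> nat) (B : forall i, 'cV[R]_(m i)) k
    (e : (\sum_(i < k.+1) m i = \sum_(i < k) m i + m k)%N) :
  castmx (e, erefl) (\mxcol_(i < k.+1) B i) =
  col_mx (\mxcol_(i < k) B i) (B k).
Proof.
apply: (canLR (castmxKV e erefl)); apply/mxcolP => i; rewrite mxcolK.
apply/matrixP => j c; rewrite (ord1 c) [RHS]mxE castmxE cast_ord_id.
set s := cast_ord _ _; have sE : s = (\sum_(l < i) m l + j)%N :> nat.
  exact: Rank_nat.
case: (ltnP i k) => [ik | ki].
  pose s' := tagnat.Rank (p_ := fun i : 'I_k => m i) (Ordinal ik) j.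
  have -> : s = lshift _ s' by apply: ord_inj; rewrite sE; exact/esym/Rank_nat.
  by rewrite col_mxEu mxcol_Rank.
have ik : i = k :> nat by apply/eqP; rewrite eqn_leq ki -ltnS ltn_ord.
clearbody s; case: i ik j s sE {ki} => i /= ilt ik j s sE; subst i.
have -> : s = rshift _ j by apply: ord_inj; rewrite sE.
by rewrite col_mxEd.
Qed.
End MxcolNat.

(** Together with [mxcol_outputs], this exhibits the inner layers as the block shared by layer
    inputs and layer outputs, in the shape that [U2bar] produces. *)
Lemma mxcol_inputs (R : realType) (m : nat -> nat) (B : forall i, 'cV[R]_(m i))
    k (k0 : (0 < k)%N)
    (e : (\sum_(i < k) m i = m 0 + \sum_(i < k.-1) m i.+1)%N) :
  castmx (e, erefl) (\mxcol_(i < k) B i) =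
  col_mx (B 0%N) (\mxcol_(i < k.-1) B i.+1).
Proof. by case: k k0 e => // k _ e; exact: mxcol_cons. Qed.

Lemma mxcol_outputs (R : realType) (m : nat -> nat) (B : forall i, 'cV[R]_(m i))
    k (k0 : (0 < k)%N)
    (e : (\sum_(i < k) m i.+1 = \sum_(i < k.-1) m i.+1 + m k)%N) :
  castmx (e, erefl) (\mxcol_(i < k) B i.+1) =
  col_mx (\mxcol_(i < k.-1) B i.+1) (B k).
Proof.
by case: k k0 e => // k _ e; exact: (mxcol_rcons (fun i => B i.+1)).
Qed.

Lemma mul_castmx (R : realType) m n p m' n' (e : m = m') (e' : n = n')
    (M : 'M[R]_(m, n)) (B : 'M[R]_(n, p)) :
  castmx (e, e') M *m castmx (e', erefl) B = castmx (e, erefl) (M *m B).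
Proof. by case: _ / e; case: _ / e'; rewrite !castmx_id. Qed.

Lemma castmx_subr (R : realType) m n m' n' (e : (m = m') * (n = n'))
    (M M' : 'M[R]_(m, n)) :
  castmx e M - castmx e M' = castmx e (M - M').
Proof. by case: e => e e'; case: _ / e; case: _ / e'; rewrite !castmx_id. Qed.

(** Off-diagonal blocks vanish, and on the diagonal the dimensions agree, so [conform_mx] returns
    the intended block. *)
Lemma mul_blockdiag_KW (R : realType) k (N : network R k) (k2 : (1 < k)%N)
    (d : forall i, 'rV[R]_(width N i.+1)) (B : forall i, 'cV[R]_(width N i)) :
  blockdiag_KW k2 d *m castmx (inputs_width N k2, erefl) (\mxcol_(i < k) B i) =
  castmx (outputs_width N k2, erefl)
    (\mxcol_(i < k) (diag_mx (d i) *m (weight N i *m B i))).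
Proof.
rewrite /blockdiag_KW mul_castmx mul_mxblock_mxrow; congr castmx.
apply: eq_mxcol => i; rewrite (bigD1 i) //= eqxx conform_mx_id big1 ?addr0.
  by rewrite mulmxA.
by move=> j /negbTE ji; rewrite eq_sym ji mul0mx.
Qed.

(** * Increments of the network and decrease of the Lyapunov function *)

Section NetworkIncrements.
Variables (R : realType) (k : nat) (N : network R k) (k2 : (1 < k)%N).
Variables x1 x2 : 'cV[R]_(width N 0).

Let delta i := hidden x1 i - hidden x2 i.

(** Once the casts are removed, [dot] is a sum over layers and neurons whose summands are the sector
    products at the two preactivations. *)
Lemma sector_dot_le0 (D : set 'cV[R]_(width N 0))
    (al be : forall i, 'rV[R]_(width N i.+1)) :
  incremental_sector_bounded D al be -> D x1 -> D x2 ->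
  dot (col_mx (\mxcol_(i < k.-1) delta i.+1) (delta k) -
       blockdiag_KW k2 al *m
         col_mx (x1 - x2) (\mxcol_(i < k.-1) delta i.+1))
      (col_mx (\mxcol_(i < k.-1) delta i.+1) (delta k) -
       blockdiag_KW k2 be *m
         col_mx (x1 - x2) (\mxcol_(i < k.-1) delta i.+1)) <= 0.
Proof.
move=> sec D1 D2; have k0 : (0 < k)%N by exact: ltnW.
set z := col_mx _ (delta k); set u := col_mx _ _.
have -> : u = castmx (inputs_width N k2, erefl) (\mxcol_(i < k) delta i).
  by rewrite mxcol_inputs.
have -> : z = castmx (outputs_width N k2, erefl) (\mxcol_(i < k) delta i.+1).
  by rewrite mxcol_outputs.
rewrite !mul_blockdiag_KW !castmx_subr dot_castmx -!mxcolB dot_mxcol.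
apply: sumr_le0 => i _; rewrite dotE; apply: sumr_le0 => j _.
have [_ /(_ (preact x1 i j 0) (preact x2 i j 0))] := sec i j (ltn_ord i).
(* The bias cancels in the difference. *)
have pre : (weight N i *m delta i) j 0 = preact x1 i j 0 - preact x2 i j 0.
  by rewrite /delta /preact mulmxBr !mxE; ring.
have coord d : (delta i.+1 - diag_mx d *m (weight N i *m delta i)) j 0 =
    act j (preact x1 i j 0) - act j (preact x2 i j 0) -
    d 0 j * (preact x1 i j 0 - preact x2 i j 0).
  rewrite -pre mul_diag_mx mxE [X in _ + X]mxE [X in _ - X]mxE.
  by congr (_ - _); rewrite /delta mxE [X in _ + X]mxE; congr (_ - _);
    exact: mxE.
rewrite !coord.
by apply; [exists x1 | exists x2].
Qed.

Lemma node_field_increment (A : 'M[R]_(width N 0)) :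
  node_field N A x1 - node_field N A x2 =
  A *m (x1 - x2) + weight_out N *m delta k.
Proof.
rewrite /node_field /net /delta !mulmxBr.
by apply/matrixP => i j; rewrite !mxE; ring.
Qed.

End NetworkIncrements.

(** Pointwise form of the decay: along two trajectories the left side is the time derivative of
    [quad_form P] at their difference. *)
Lemma lyapunov_decrease (R : realType) (k : nat) (k2 : (2 <= k)%N)
    (N : network R k) (A : 'M[R]_(width N 0)) (D : set 'cV[R]_(width N 0))
    (al be : forall i, 'rV[R]_(width N i.+1))
    (P : 'M[R]_(width N 0)) (p_lo mu : R) x1 x2 :
  incremental_sector_bounded D al be -> P^T = P ->
  0 < p_lo -> 0 < mu -> loewner_le p_lo%:M P ->
  (let n := width N 0 in
   let mk := width N k in
   let a := inner_width N in
   let Wout := weight_out N in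
   let Q1 := blockdiag_KW k2 al in
   let Q2 := blockdiag_KW k2 be in
   let U1 := U1bar R n a mk in
   let U2 := U2bar R n a mk in
   loewner_le
     (U1^T *m block3_mx
                (- mu%:M) P                    0
                P         (A^T *m P + P *m A)  (P *m Wout)
                0         (Wout^T *m P)        0 *m U1
      + U2^T *m block3_mx
                  (0 : 'M[R]_n) 0                       0
                  0             ((-2) *: (Q1^T *m Q2))  (Q1^T + Q2^T)
                  0             (Q1 + Q2)               (- 2%:M) *m U2)
     0) ->
  D x1 -> D x2 ->
  2 * dot (P *m (x1 - x2)) (node_field N A x1 - node_field N A x2) <=
  - (p_lo / mu) * quad_form P (x1 - x2).
Proof.
move=> sec PT p0 mu0 [_ lo] [_ lmi] D1 D2.
have := sector_dot_le0 k2 sec D1 D2; rewrite node_field_increment.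
set x := x1 - x2; set s := \mxcol_(i < _) _ => /=.
set z := _ - hidden x2 k => sec_le0.
have /(_ (col_mx ((p_lo / mu) *: x) (col_mx x (col_mx s z)))) := lmi.
rewrite quad_formB (quad_form_lmi _ _ _ _ _ _ _ _ _ PT).
rewrite quad_formE mul0mx dot0r subr0.
rewrite !(dotZl, dotZr) -quad_formE.
have := lo x; rewrite quad_formB quad_form_scalar.
set V := quad_form P x; set dx := dot x x => lo_x.
(* With [e = p_lo / mu], the terms containing the free vector add up to
   [- e * (p_lo * dx) + 2 * e * V], which is at least [e * V] by [lo_x]. *)
have -> : - mu * (p_lo / mu * (p_lo / mu * dx)) = - (p_lo / mu) * (p_lo * dx).
  by field; rewrite gt_eqF.
have e0 : 0 < p_lo / mu by rewrite divr_gt0.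
have := ler_wpM2l (ltW e0) lo_x; rewrite mulr0.
move: sec_le0; lra.
Qed.

(** * Equivalence of an arbitrary norm with the max norm *)

Lemma norm_coord_le (R : realType) (m p : nat) (v : 'M[R]_(m, p)) i j : `|v i j| <= `|v|.
Proof.
by rewrite [leRHS]/Num.Def.normr /= mx_normrE; exact: (le_bigmax _ _ (i, j)).
Qed.

(** Serves to pass from columns to the row vectors on which the extreme value theorem is applied. *)
Lemma norm_trmx (R : realType) (m p : nat) (v : 'M[R]_(m, p)) : `|v^T| = `|v|.
Proof.
have le (q r : nat) (w : 'M[R]_(q, r)) : `|w^T| <= `|w|.
  rewrite [leLHS]/Num.Def.normr /= mx_normrE; apply: bigmax_le => // i _.
  by rewrite mxE norm_coord_le.
by apply/eqP; rewrite eq_le le -{1}[v]trmxK le.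
Qed.

Section NormEquivalence.
Variables (R : realType) (n : nat) (nrm : 'cV[R]_n -> R).
Hypothesis nrm_norm : is_norm nrm.

Let nrmD u v : nrm (u + v) <= nrm u + nrm v. Proof. by case: nrm_norm. Qed.
Let nrmZ c v : nrm (c *: v) = `|c| * nrm v. Proof. by case: nrm_norm. Qed.

Lemma is_norm0 : nrm 0 = 0.
Proof. by rewrite -(scale0r 0) nrmZ normr0 mul0r. Qed.

Lemma is_normN v : nrm (- v) = nrm v.
Proof. by rewrite -scaleN1r nrmZ normrN1 mul1r. Qed.

(** Follows from [0 = nrm (v - v) <= nrm v + nrm (- v) = 2 * nrm v]. *)
Lemma is_norm_ge0 v : 0 <= nrm v.
Proof. by have := nrmD v (- v); rewrite subrr is_norm0 is_normN; lra. Qed.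

Lemma is_norm_gt0 v : v != 0 -> 0 < nrm v.
Proof.
move=> v0; rewrite lt_def is_norm_ge0 andbT; apply: contra v0 => /eqP vv.
by apply/eqP; case: nrm_norm => _ _; exact.
Qed.

Lemma is_norm_sum (I : Type) (r : seq I) (F : I -> 'cV[R]_n) :
  nrm (\sum_(i <- r) F i) <= \sum_(i <- r) nrm (F i).
Proof.
elim/big_ind2: _ => [|u a v b ua vb|//]; first by rewrite is_norm0.
by apply: le_trans (nrmD _ _) _; rewrite lerD.
Qed.

Lemma is_norm_le : exists2 M, 0 < M & forall v, nrm v <= M * `|v|.
Proof.
(* The sum comes from expanding [v] in the standard basis; the added 1 keeps the constant positive
   when [n = 0]. *)
exists (\sum_i nrm (delta_mx i 0) + 1).
  by rewrite ltr_wpDl // sumr_ge0 // => i _; exact: is_norm_ge0.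
move=> v; rewrite {1}(matrix_sum_delta v).
apply: le_trans (is_norm_sum _ _) _.
rewrite mulrDl mul1r; apply: ler_wpDr => //.
rewrite mulr_suml; apply: ler_sum => i _; rewrite big_ord1 nrmZ mulrC.
by rewrite ler_wpM2l ?is_norm_ge0 ?norm_coord_le.
Qed.

(** By compactness [nrm] attains its minimum on the unit sphere of the max norm; the minimum is
    positive, and homogeneity extends the bound to all vectors. *)
Lemma is_norm_ge : exists2 m, 0 < m & forall v, m * `|v| <= nrm v.
Proof.
have [M M0 leM] := is_norm_le.
pose f (w : 'rV[R]_n) := nrm w^T.
have cf : continuous f.
  have df w w' : f w - f w' <= M * `|w' - w|.
    have := nrmD (w - w')^T w'^T; rewrite -linearD subrK -/(f w) -/(f w').
    by have := leM (w - w')^T; rewrite norm_trmx distrC; lra.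
  move=> w; apply/(@cvgrPdist_le _ _ _ (nbhs w) (nbhs_filter w)) => e e0.
  near=> w'.
  have ww' : M * `|w - w'| <= e.
    rewrite -ler_pdivlMl //; near: w'.
    apply: (@cvgr_dist_le _ _ _ (nbhs w) (nbhs_filter w) id w cvg_id).
    by rewrite mulr_gt0 ?invr_gt0.
  by rewrite ler_norml lerNl opprB !(le_trans (df _ _)) // distrC.
pose S := [set w : 'rV[R]_n | `|w| = 1].
(* An empty sphere forces every vector to be zero, the case [n = 0], and then any positive constant
   works. *)
have [S0|/set0P S0] := eqVneq S set0.
  exists 1 => // v; have [->|v0] := eqVneq v 0.
    by rewrite normr0 mulr0 is_norm0.
  suff : S (`|v|^-1 *: v^T) by rewrite S0.
  by rewrite /S /= normrZ norm_trmx normfV normr_id mulVf ?normr_eq0.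
have cS : compact S.
  apply: bounded_closed_compact.
    exists 1; split; first exact: num_real.
    by move=> y y1 w /= ->; exact: ltW.
  apply: (@closed_comp _ _ (fun w : 'rV[R]_n => `|w|) [set 1 : R]).
    by move=> w _; exact: norm_continuous.
  exact: closed_eq.
have [c cS1 fc] := EVT_min_rV S0 cS (continuous_subspaceT cf).
rewrite inE /S /= in cS1.
exists (f c) => [|v].
  apply: is_norm_gt0; apply/negP => /eqP c0.
  move: cS1; rewrite -[c]trmxK c0 trmx0 normr0 => /eqP.
  by rewrite eq_sym oner_eq0.
have [->|v0] := eqVneq v 0; first by rewrite normr0 mulr0 is_norm0.
have v_gt0 : 0 < `|v| by rewrite normr_gt0.
have /fc : (`|v|^-1 *: v^T) \in S.
  by rewrite inE /S /= normrZ norm_trmx normfV normr_id mulVf ?normr_eq0.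
rewrite /f linearZ /= trmxK nrmZ normfV normr_id mulrC.
by rewrite ler_pdivlMr.
Unshelve. all: by end_near. Qed.

End NormEquivalence.

(** * Differential inequalities and derivatives along solutions *)

(** Gronwall's argument: [expR (rho * s) * g s] has nonpositive derivative, hence does not exceed
    its value at 0. *)
Lemma exp_decay (R : realType) (g dg : R -> R) (rho : R) :
  (forall t : R, 0 <= t -> is_derive t 1 g (dg t)) ->
  (forall t : R, 0 <= t -> dg t <= - rho * g t) ->
  forall t : R, 0 <= t -> g t <= expR (- rho * t) * g 0.
Proof.
move=> g' g'_le t t0; pose h (s : R) := expR (rho * s) * g s.
have h' (s : R) : 0 <= s ->
    is_derive s 1 h (expR (rho * s) * (dg s + rho * g s)).
  move=> s0; have := g' s s0 => g's.
  apply: is_derive_eq.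
  rewrite /GRing.scale /=; ring.
have hle : h t <= h 0.
  have in0 (s : R) : s \in `[0, t] -> 0 <= s by rewrite in_itv /= => /andP[].
  have in0' (s : R) : s \in `]0, t[ -> 0 <= s.
    by rewrite in_itv /= => /andP[/ltW].
  apply: (@ler0_derive1_le_cc _ h 0 t) => //.
  - by move=> s /in0' s0; have := h' s s0; case.
  - move=> s /in0' s0; have := h' s s0 => h's.
    rewrite derive1E derive_val pmulr_rle0 ?expR_gt0 //.
    by rewrite -lerBrDr sub0r -mulNr; exact: g'_le.
  - by apply: derivable_within_continuous => s /in0 s0; have := h' s s0; case.
  - by rewrite in_itv /= t0 lexx.
  - by rewrite in_itv /= lexx t0.
move: hle; rewrite /h mulr0 expR0 mul1r => hle.
by rewrite mulNr expRN ler_pdivlMl ?expR_gt0.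
Qed.

Section DeriveDot.
Variables (R : realType) (t : R).

Lemma is_derive_dot n (u v : R -> 'cV[R]_n) (du dv : 'cV[R]_n) :
  (forall i, is_derive t 1 (fun s => u s i 0) (du i 0)) ->
  (forall i, is_derive t 1 (fun s => v s i 0) (dv i 0)) ->
  is_derive t 1 (fun s => dot (u s) (v s)) (dot du (v t) + dot (u t) dv).
Proof.
move=> u' v'.
have -> : (fun s => dot (u s) (v s)) = \sum_i (fun s => u s i 0 * v s i 0).
  by apply/funext => s; rewrite dotE fct_sumE.
apply: is_derive_eq; rewrite !dotE -big_split /=; apply: eq_bigr => i _.
rewrite /GRing.scale /=; ring.
Qed.

Lemma is_derive_mulmx m n (M : 'M[R]_(m, n)) (u : R -> 'cV[R]_n)
    (du : 'cV[R]_n) :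
  (forall i, is_derive t 1 (fun s => u s i 0) (du i 0)) ->
  forall i, is_derive t 1 (fun s => (M *m u s) i 0) ((M *m du) i 0).
Proof.
move=> u' i.
have -> : (fun s => (M *m u s) i 0) = \sum_j (fun s => M i j * u s j 0).
  by apply/funext => s; rewrite mxE fct_sumE.
apply: is_derive_eq; rewrite mxE; apply: eq_bigr => j _.
rewrite /GRing.scale /=; ring.
Qed.

(** The product rule gives two terms, equal by the symmetry of [P]; hence the factor 2. *)
Lemma is_derive_quad_form n (P : 'M[R]_n) (u : R -> 'cV[R]_n) (du : 'cV[R]_n) :
  P^T = P -> (forall i, is_derive t 1 (fun s => u s i 0) (du i 0)) ->
  is_derive t 1 (fun s => quad_form P (u s)) (2 * dot (P *m u t) du).
Proof.
move=> PT u'.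
have -> : (fun s => quad_form P (u s)) = (fun s => dot (u s) (P *m u s)).
  by apply/funext => s; rewrite quad_formE.
have := is_derive_dot u' (is_derive_mulmx P u') => V'.
apply: is_derive_eq.
by rewrite [dot (u t) _]dot_mulmxr PT dotC mulrC mulr_natr mulr2n.
Qed.

End DeriveDot.

(* Continuing a solution linearly to negative times makes the derivative at 0
   two-sided. *)
Lemma solution_extension (R : realType) n (f : 'cV[R]_n -> 'cV[R]_n) x :
  solution f x ->
  exists2 y, forall t : R, 0 <= t -> y t = x t &
    forall t : R, 0 <= t -> forall i,
      is_derive t 1 (fun s => y s i 0) (f (x t) i 0).
Proof.
move=> xsol; pose y (t : R) := if 0 <= t then x t else x 0 + t *: f (x 0).
have yE (t : R) : 0 <= t -> y t = x t by rewrite /y => ->.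
exists y => // t t0 i.
suff yt : h^-1 *: (y (h *: 1 + t) i 0 - y t i 0) @[h --> (0:R)^'] -->
    f (x t) i 0.
  split; first by apply/cvg_ex; exists (f (x t) i 0).
  exact: (cvg_lim (@norm_hausdorff _ _) yt).
apply/cvgrPdist_le => e e0.
have := xsol t t0 => /cvgrPdist_le /(_ e e0) xt.
(* For [t > 0] small increments keep [t + h] nonnegative, so the linear piece matters only at
   [t = 0]. *)
have t_small : \forall h \near (0:R)^', 0 < t -> 0 <= t + h.
  have [t_gt0|] := ltP 0 t; last by move=> _; exact: nearW.
  near=> h => _; rewrite -lerBlDl sub0r.
  have : `|h| <= t by near: h; exact: dnbhs0_le.
  by rewrite ler_norml => /andP[].
near=> h.
rewrite (yE t) // [h *: 1 + t]addrC /GRing.scale /= mulr1.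
have h0 : h != 0 by near: h; exact: nbhs_dnbhs_neq.
have [th|th] := leP 0 (t + h).
  rewrite yE //.
  have xth : `|f (x t) - h^-1 *: (x (t + h) - x t)| <= e.
    by move: th; near: h; exact: xt.
  by apply: le_trans xth; apply: le_trans (norm_coord_le _ i 0); rewrite !mxE.
have t_eq0 : t = 0.
  have th_ge0 : 0 < t -> 0 <= t + h by near: h; exact: t_small.
  by apply/eqP; rewrite eq_le t0 andbT leNgt;
    apply: contraTN th => /th_ge0; rewrite -leNgt.
(* On the linear piece the difference quotient at 0 equals [f (x 0)] exactly. *)
move: th; rewrite t_eq0 add0r /y => th.
rewrite [0 <= h]leNgt th /= !mxE.
rewrite addrAC subrr add0r mulKf // subrr normr0 ltW //.
Unshelve. all: by end_near. Qed.

(** * From decay of the quadratic form to contraction in the given norm *)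

(** The max norm is attained at some entry, whose square is one of the summands of [dot v v]. *)
Lemma sqr_norm_le_dot (R : realType) n (v : 'cV[R]_n) : `|v| ^+ 2 <= dot v v.
Proof.
have [->|] := eqVneq `|v| 0.
  by rewrite expr0n dotE sumr_ge0 // => i _; rewrite -expr2 sqr_ge0.
move=> /mx_norm_neq0 [[i j] /= vE]; rewrite [`|v|]vE.
rewrite (ord1 j) real_normK ?num_real //.
rewrite dotE (bigD1 i) //= -expr2 lerDl sumr_ge0 // => l _.
by rewrite -expr2 sqr_ge0.
Qed.

Lemma dot_le_sqr_norm (R : realType) n (v : 'cV[R]_n) :
  dot v v <= n%:R * `|v| ^+ 2.
Proof.
rewrite dotE -[n in n%:R]card_ord -sum1_card natr_sum mulr_suml.
apply: ler_sum => i _; rewrite mul1r -expr2 -real_normK ?num_real //.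
by rewrite lerXn2r ?nnegrE ?norm_coord_le.
Qed.

Lemma quad_form_exp_decay (R : realType) n (f : 'cV[R]_n -> 'cV[R]_n)
    (P : 'M[R]_n) (rho : R) x1 x2 :
  P^T = P -> solution f x1 -> solution f x2 ->
  (forall t : R, 0 <= t ->
    2 * dot (P *m (x1 t - x2 t)) (f (x1 t) - f (x2 t)) <=
    - rho * quad_form P (x1 t - x2 t)) ->
  forall t : R, 0 <= t ->
    quad_form P (x1 t - x2 t) <=
    expR (- rho * t) * quad_form P (x1 0 - x2 0).
Proof.
move=> PT /solution_extension[y1 y1E y1'] /solution_extension[y2 y2E y2'].
move=> dec t t0.
(* The extensions agree with the solutions at nonnegative times and have the two-sided derivatives
   that [exp_decay] requires. *)
rewrite -(y1E t) // -(y2E t) // -(y1E 0) // -(y2E 0) //.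
apply: (exp_decay (g := fun s => quad_form P (y1 s - y2 s))
  (dg := fun s => 2 * dot (P *m (y1 s - y2 s)) (f (x1 s) - f (x2 s)))) t0.
  move=> s s0; apply: (is_derive_quad_form (u := fun s => y1 s - y2 s) PT) => i.
  have -> : (fun s => (y1 s - y2 s) i 0) =
      (fun s => y1 s i 0) - (fun s => y2 s i 0).
    by apply/funext => r; rewrite !mxE.
  have := y1' s s0 i => d1; have := y2' s s0 i => d2.
  by rewrite !mxE; exact: is_deriveB.
by move=> s s0; rewrite y1E // y2E //; exact: dec.
Qed.

Lemma contractive_of_quad_form (R : realType) n (f : 'cV[R]_n -> 'cV[R]_n)
    (C : set 'cV[R]_n) (P : 'M[R]_n) (p_lo p_hi rho : R) nrm :
  is_norm nrm -> 0 < p_lo -> 0 < p_hi -> 0 < rho ->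
  loewner_le p_lo%:M P -> loewner_le P p_hi%:M ->
  (forall x1 x2, solution f x1 -> solution f x2 -> C (x1 0) -> C (x2 0) ->
    forall t : R, 0 <= t -> quad_form P (x1 t - x2 t) <=
      expR (- rho * t) * quad_form P (x1 0 - x2 0)) ->
  contractive f C nrm.
Proof.
move=> nrm_norm p0 q0 r0 [_ lo] [_ hi] dec.
have [M M0 leM] := is_norm_le nrm_norm.
have [m m0 lem] := is_norm_ge nrm_norm.
(* [K] is the square root of the ratio of the two bounds on [quad_form P] by the squared max norm;
   [n.+1] in place of [n] keeps it positive in dimension 0. *)
pose K := Num.sqrt (p_hi * n.+1%:R / p_lo).
have K0 : 0 < K by rewrite sqrtr_gt0 divr_gt0 ?mulr_gt0.
(* [M] and [m] convert between the max norm and [nrm]; the rate is halved because [quad_form P]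
   scales as the square of a norm. *)
exists (M * K / m), (rho / 2); split; rewrite ?divr_gt0 ?mulr_gt0 //.
move=> x1 x2 s1 s2 C1 C2 t t0.
have := dec x1 x2 s1 s2 C1 C2 t t0.
set v := x1 t - x2 t; set w := x1 0 - x2 0 => vw.
set E := expR (- (rho / 2) * t).
have E0 : 0 < E by exact: expR_gt0.
have EE : expR (- rho * t) = E ^+ 2.
  by rewrite -expRM_natl; congr expR; field.
have Vlo : p_lo * `|v| ^+ 2 <= quad_form P v.
  have := lo v; rewrite quad_formB quad_form_scalar subr_le0; apply: le_trans.
  by rewrite ler_pM2l // sqr_norm_le_dot.
have Vhi : quad_form P w <= p_hi * (n.+1%:R * `|w| ^+ 2).
  have := hi w; rewrite quad_formB quad_form_scalar subr_le0.
  move=> /le_trans; apply.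
  rewrite ler_pM2l // (le_trans (dot_le_sqr_norm _)) //.
  by rewrite ler_wpM2r ?sqr_ge0 // ler_nat.
have vw_norm : `|v| <= E * K * `|w|.
  rewrite -(@ler_pXn2r _ 2) ?nnegrE ?mulr_ge0 ?(ltW E0) ?(ltW K0) //.
  rewrite !exprMn sqr_sqrtr; last by rewrite ltW // divr_gt0 ?mulr_gt0.
  rewrite -(ler_pM2l p0) (le_trans Vlo) // (le_trans vw) // EE.
  have -> : p_lo * (E ^+ 2 * (p_hi * n.+1%:R / p_lo) * `|w| ^+ 2) =
            E ^+ 2 * (p_hi * (n.+1%:R * `|w| ^+ 2)).
    by field; rewrite gt_eqF.
  by rewrite ler_pM2l // exprn_gt0.
apply: le_trans (leM v) _.
apply: (@le_trans _ _ (M * (E * K * `|w|))); first by rewrite ler_pM2l.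
have -> : M * K / m * E * nrm w = M * (E * K) * (nrm w / m).
  by field; rewrite gt_eqF.
rewrite mulrA ler_pM2l ?mulr_gt0 // ler_pdivlMr // mulrC; exact: lem.
Qed.

Unset Implicit Arguments.

Theorem mainTheorem4 (R : realType) (k : nat) (k2 : (2 <= k)%N)
    (N : network R k) (A : 'M[R]_(width N 0))
    (D C : set 'cV[R]_(width N 0))
    (al be : forall i, 'rV[R]_(width N i.+1))
    (P : 'M[R]_(width N 0)) (p_lo p_hi mu : R)
    (nrm : 'cV[R]_(width N 0) -> R) :
  is_norm nrm ->
  act_differentiable N ->
  incremental_sector_bounded D al be ->
  C `<=` D ->
  forward_complete_invariant (node_field N A) C ->
  posdef_mx P -> 0 < p_lo -> 0 < p_hi -> 0 < mu ->
  loewner_le p_lo%:M P -> loewner_le P p_hi%:M ->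
  (let n := width N 0 in
   let mk := width N k in
   let a := inner_width N in
   let Wout := weight_out N in
   let Q1 := blockdiag_KW k2 al in
   let Q2 := blockdiag_KW k2 be in
   let U1 := U1bar R n a mk in
   let U2 := U2bar R n a mk in
   loewner_le
     (U1^T *m block3_mx
                (- mu%:M) P                    0
                P         (A^T *m P + P *m A)  (P *m Wout)
                0         (Wout^T *m P)        0 *m U1
      + U2^T *m block3_mx
                  (0 : 'M[R]_n) 0                       0
                  0             ((-2) *: (Q1^T *m Q2))  (Q1^T + Q2^T)
                  0             (Q1 + Q2)               (- 2%:M) *m U2)
     0) ->
  contractive (node_field N A) C nrm.
Proof.
move=> nrm_norm _ sec CD [_ inv] [PT _] p0 q0 mu0 lo hi lmi.
apply: (contractive_of_quad_form (rho := p_lo / mu) nrm_norm p0 q0 _ lo hi).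
  by rewrite divr_gt0.
move=> x1 x2 s1 s2 C1 C2.
apply: (quad_form_exp_decay PT s1 s2) => t t0.
(* Forward invariance keeps both trajectories in [C], hence in [D], where the sector bounds hold. *)
by apply: (lyapunov_decrease sec PT p0 mu0 lo lmi); apply: CD; exact: inv.
Qed.
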